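(* Let $k\ge 1$, let $m_1,\dots,m_k$ be integers with $1\le m_i\le 4$ for every $i$ and $n=m_1+\dots+m_k>3$, and let $\mathcal{R}=\{r_{(1,1)},\dots,r_{(1,m_1)},r_{(2,1)},\dots,r_{(2,m_2)},\dots,r_{(k,1)},\dots,r_{(k,m_k)}\}$ be a family of positive real radii such that $r_{(i,1)}=\dots=r_{(i,m_i)}$ for each $i=1,\dots,k$, and the $k$ values $r_{(1,1)},\dots,r_{(k,1)}$ are pairwise distinct (so each radius value is repeated at most four times). Then there exists a strictly convex configuration of points $V=\{v_{(i,j)} : 1\le i\le k,\ 1\le j\le m_i\}$ in the plane $\mathbb{R}^2$ with respect to the radii $\mathcal{R}$ (in the sense defined in the context).
   Context: Fix the origin $O\in\mathbb{R}^2$. The radius of a point $v$ is its Euclidean distance $d(O,v)$ from $O$. A polygon is a closed region bounded by a closed chain of segments joining cyclically consecutive vertices; it is simple if the chain does not intersect itself except at the vertices. A simple polygon is convex if it is a convex set, equivalently if every interior angle at a vertex is $\le\pi$ (so listed vertices may be collinear with their neighbours, but the polygon is a genuine two-dimensional region); it is strictly convex if every interior angle at a vertex is $<\pi$. Given a finite family of $n$ positive reals (repetitions allowed), a (strictly) convex configuration with respect to these radii is a choice of $n$ distinct points in $\mathbb{R}^2$, one for each member of the family and at that distance from $O$, which, in some counterclockwise cyclic order, are exactly the vertices of a simple (strictly) convex polygon $P$ with $O\in P$. The cyclic order of the vertices is not prescribed, and edge lengths are free. *)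

(* Defs.v *)
From HB Require Import structures.
From mathcomp Require Import all_boot all_order all_algebra.
From mathcomp Require Import all_classical all_reals all_analysis.

Set Implicit Arguments.
Unset Strict Implicit.
Unset Printing Implicit Defensive.

Import Order.TTheory GRing.Theory Num.Theory numFieldNormedType.Exports.

Local Open Scope classical_set_scope.
Local Open Scope ring_scope.

Section Plane.
Context {R : realType}.
Implicit Types u v p q : R * R.

(* The library norm on R * R is the sup norm, so the Euclidean structure is
   spelled out; the topology and the bounded sets are the same for both. *)
Definition dot u v : R := u.1 * v.1 + u.2 * v.2.
Definition cross u v : R := u.1 * v.2 - u.2 * v.1.
Definition enorm u : R := Num.sqrt (dot u u).
Definition edist p q : R := enorm (p - q).

(* Rotation by pi/2 counterclockwise. *)
Definition rot90 u : R * R := (- u.2, u.1).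

(* For nonzero u and v, the angle in [0, 2 pi[ by which u has to be rotated
   counterclockwise to get the direction of v. *)
Definition ccw_angle u v : R :=
  let a := acos (dot u v / (enorm u * enorm v)) in
  if 0 <= cross u v then a else 2 * pi - a.

Definition segment p q : set (R * R) :=
  [set (1 - t) *: p + t *: q | t in `[0, 1]].

End Plane.

(* A closed chain is given by its vertices w : 'I_n -> R * R in cyclic order;
   ordS and ord_pred are the cyclic successor and predecessor on 'I_n. *)
Section Polygon.
Context {R : realType} (n : nat) (w : 'I_n -> R * R).

Definition edge (i : 'I_n) : set (R * R) := segment (w i) (w (ordS i)).

Definition chain : set (R * R) := \bigcup_(i in [set: 'I_n]) edge i.

(* The closed region bounded by the chain: the chain together with the bounded
   connected components of its complement. *)
Definition region : set (R * R) :=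
  chain `|`
  [set p | ~ chain p /\ bounded_set (connected_component (~` chain) p)].

(* Two different edges meet only at a vertex where one of them ends and the
   other one, next in the cyclic order, starts. *)
Definition simple_polygon : Prop :=
  [/\ (3 <= n)%N, injective w &
      forall (i j : 'I_n) (p : R * R), i != j -> edge i p -> edge j p ->
        (j = ordS i /\ p = w j) \/ (i = ordS j /\ p = w i)].

(* Traversing the boundary in the given order, the region is on the left: the
   points close to an inner point of an edge, on its left side, are in it. *)
Definition counterclockwise : Prop :=
  forall (i : 'I_n) (s : R), 0 < s < 1 ->
    \forall t \near 0^'+,
      region ((1 - s) *: w i + s *: w (ordS i)
              + t *: rot90 (w (ordS i) - w i)).

(* This is the interior angle at w i when the vertices of the simple polygon
   are listed counterclockwise: the angle from the edge to the next vertex to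
   the edge to the previous one, swept through the region. *)
Definition interior_angle (i : 'I_n) : R :=
  ccw_angle (w (ordS i) - w i) (w (ord_pred i) - w i).

Definition ccw_strictly_convex_polygon : Prop :=
  [/\ simple_polygon, counterclockwise & forall i, interior_angle i < pi].

End Polygon.

(* The points v i, for i in the index type I of the family of radii r, form a
   strictly convex configuration; s is the cyclic order of the vertices. *)
Definition strictly_convex_configuration {R : realType} (I : finType)
    (r : I -> R) (v : I -> R * R) : Prop :=
  [/\ injective v,
      forall i, edist (0, 0) (v i) = r i &
      exists s : 'I_#|I| -> I,
        [/\ bijective s, ccw_strictly_convex_polygon (v \o s) &
            region (v \o s) (0, 0)]].

(* Main.v *)
(* An ellipse centred at O whose half axes d and L satisfy d < r < L for all radii
   r meets the circle of radius r in four points, one in each open quadrant, and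
   points of an ellipse are in strictly convex position. Number all the points so
   that those of equal radius are consecutive, and put the one of rank h in the
   quadrant h mod 4: the points of one circle are then distinct, and as there are
   at least four points every quadrant is hit, so O is in the polygon. *)
Require Import Defs.
From HB Require Import structures.
From mathcomp Require Import all_boot all_order all_algebra.
From mathcomp Require Import all_classical all_reals all_analysis.
From mathcomp Require Import ring lra.

Set Implicit Arguments.
Unset Strict Implicit.
Unset Printing Implicit Defensive.

Import Order.TTheory GRing.Theory Num.Theory numFieldNormedType.Exports.

Local Open Scope classical_set_scope.
Local Open Scope ring_scope.

(** * Signed areas of triangles, and cyclic successors *)

Definition orient {R : realType} (a b p : R * R) : R := cross (b - a) (p - a).

Lemma orientE {R : realType} (a b p : R * R) :
  orient a b p = (b.1 - a.1) * (p.2 - a.2) - (b.2 - a.2) * (p.1 - a.1).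
Proof. by []. Qed.

Lemma orient_line {R : realType} (a b p q : R * R) (t : R) :
  orient a b ((1 - t) *: p + t *: q) =
  (1 - t) * orient a b p + t * orient a b q.
Proof.
have E1 : ((1 - t) *: p + t *: q).1 = (1 - t) * p.1 + t * q.1 by [].
have E2 : ((1 - t) *: p + t *: q).2 = (1 - t) * p.2 + t * q.2 by [].
by rewrite !orientE E1 E2; ring.
Qed.

Lemma orient_left {R : realType} (a b : R * R) : orient a b a = 0.
Proof. by rewrite orientE; ring. Qed.

Lemma orient_right {R : realType} (a b : R * R) : orient a b b = 0.
Proof. by rewrite orientE; ring. Qed.

Lemma orient_continuous {R : realType} (a b : R * R) : continuous (orient a b).
Proof.
move=> p.
have -> : orient a b = fun q : R * R =>
    (b.1 - a.1) * (q.2 - a.2) - (b.2 - a.2) * (q.1 - a.1) by [].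
apply: cvgB; (apply: cvgM; first exact: cvg_cst).
  by apply: cvgB; [exact: cvg_snd|exact: cvg_cst].
by apply: cvgB; [exact: cvg_fst|exact: cvg_cst].
Qed.

Lemma ordS_neq n (i : 'I_n) : (2 <= n)%N -> ordS i != i.
Proof.
move=> n2; apply/eqP => /(congr1 val) /=.
have := ltn_ord i; rewrite leq_eqVlt => /orP[/eqP e|l].
  by rewrite {1}e modnn => i0; move: n2; rewrite -e -i0.
by rewrite modn_small // => /eqP; rewrite gtn_eqF.
Qed.

Lemma ordS2_neq n (i : 'I_n) : (3 <= n)%N -> ordS (ordS i) != i.
Proof.
move=> n3; apply/eqP => /(congr1 val) /=.
have ilt := ltn_ord i.
have [l|] := ltnP i.+1 n.
  rewrite (modn_small l); have [l2|] := ltnP i.+2 n.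
    by rewrite modn_small // => /eqP; rewrite gtn_eqF.
  move=> g; have e : i.+2 = n by apply/eqP; rewrite eqn_leq l g.
  by rewrite e modnn => i0; move: n3; rewrite -e -i0.
move=> g; have e : i.+1 = n by apply/eqP; rewrite eqn_leq ilt g.
rewrite {1}e modnn modn_small ?(ltn_trans _ n3) // => i0.
by move: n3; rewrite -e -i0.
Qed.

(** * Polygons in which every edge has all other vertices strictly on its left *)

Section ConvexPolygon.
Context {R : realType} (n : nat) (w : 'I_n -> R * R).
Hypothesis n_ge3 : (3 <= n)%N.
Hypothesis convex : forall i j : 'I_n, j != i -> j != ordS i ->
  0 < orient (w i) (w (ordS i)) (w j).

Let Sneq (i : 'I_n) : ordS i != i := ordS_neq i (ltnW n_ge3).
Let SSneq (i : 'I_n) : ordS (ordS i) != i := ordS2_neq i n_ge3.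

Lemma vertex_orient_ge0 i j : 0 <= orient (w i) (w (ordS i)) (w j).
Proof.
have [->|ji] := eqVneq j i; first by rewrite orient_left.
have [->|jSi] := eqVneq j (ordS i); first by rewrite orient_right.
exact/ltW/convex.
Qed.

Lemma turn_gt0 i :
  0 < cross (w (ordS i) - w i) (w (ordS (ordS i)) - w (ordS i)).
Proof.
have := convex (SSneq i) (Sneq (ordS i)); rewrite orientE /cross /=.
by lra.
Qed.

Lemma vertex_inj : injective w.
Proof.
move=> i j wij; apply/eqP; apply: contraT => ij.
have [ji|jSi] := eqVneq j (ordS i).
  have := turn_gt0 i; rewrite -ji -wij subrr /cross /= !mul0r subrr.
  by rewrite ltxx.
have := convex (i:=i) (j:=j); rewrite eq_sym ij jSi => /(_ isT isT).
by rewrite -wij orient_left ltxx.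
Qed.

Lemma edge_orient i j p : edge w j p -> 0 <= orient (w i) (w (ordS i)) p.
Proof.
move=> [t /=]; rewrite in_itv /= => /andP[t0 t1] <-; rewrite orient_line.
by rewrite addr_ge0 ?mulr_ge0 ?vertex_orient_ge0 ?subr_ge0.
Qed.

Lemma edge_orient0 i p : edge w i p -> orient (w i) (w (ordS i)) p = 0.
Proof.
by move=> [t /= _ <-]; rewrite orient_line orient_left orient_right !mulr0 addr0.
Qed.

(** A point of edge [j] on the line of edge [i] makes a weighted mean of two nonnegative values of
    [orient] vanish. For consecutive edges exactly one value is positive, which forces the common
    vertex; otherwise both are positive, a contradiction. *)
Lemma simple_convex : simple_polygon w.
Proof.
split=> // [|i j p ij pi pj]; first exact: vertex_inj.
have := edge_orient0 pi; case: pj => t /=; rewrite in_itv /= => /andP[t0 t1] <-.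
rewrite orient_line.
have ge0 := vertex_orient_ge0 i.
have [ji|jSi] := eqVneq j (ordS i).
- have jj := convex (i:=i) (j:=ordS j).
  subst j; move: jj; rewrite SSneq Sneq => /(_ isT isT) gt0.
  rewrite orient_right mulr0 add0r => /eqP; rewrite mulf_eq0 (gt_eqF gt0) orbF.
  by move=> /eqP ->; left; split=> //; rewrite subr0 scale1r scale0r addr0.
have gt0 : 0 < orient (w i) (w (ordS i)) (w j) by apply: convex; rewrite // eq_sym.
have [Sji|Sji] := eqVneq (ordS j) i.
  rewrite Sji orient_left mulr0 addr0 => /eqP.
  rewrite mulf_eq0 (gt_eqF gt0) orbF subr_eq0 => /eqP <-.
  by right; split=> //; rewrite subrr scale1r scale0r add0r.
have gt1 : 0 < orient (w i) (w (ordS i)) (w (ordS j)).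
  by apply: convex => //; rewrite (inj_eq (@ordS_inj n)) eq_sym.
move=> e; have : 0 < (1 - t) * orient (w i) (w (ordS i)) (w j)
    + t * orient (w i) (w (ordS i)) (w (ordS j)).
  move: t0; rewrite le_eqVlt => /predU1P[<-|t0].
    by rewrite subr0 mul1r mul0r addr0.
  by rewrite ltr_wpDl ?mulr_gt0 // mulr_ge0 ?(ltW gt0) ?subr_ge0.
by rewrite e ltxx.
Qed.

(* The sum is twice the area of the polygon; it bounds each of its terms at a
   point where they are all nonnegative. *)
Lemma sum_orient p q : \sum_i orient (w i) (w (ordS i)) p =
  \sum_i orient (w i) (w (ordS i)) q.
Proof.
have split_sum u : \sum_i orient (w i) (w (ordS i)) u =
    \sum_i cross (w i) (w (ordS i)).
  have telescope : \sum_i cross (w (ordS i)) u = \sum_i cross (w i) u.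
    exact/esym/(reindex_inj (@ordS_inj n)).
  rewrite (eq_bigr (fun i => cross (w i) (w (ordS i)) +
    (cross (w (ordS i)) u - cross (w i) u))) => [|i _].
    by rewrite big_split /= [X in _ + X]sumrB telescope subrr addr0.
  by rewrite orientE /cross; ring.
by rewrite !split_sum.
Qed.

(** The intersection of the closed left half-planes of the edges: sign conditions that serve to
    prove membership in [region w]. *)
Definition hull_region : set (R * R) :=
  [set p | forall i, 0 <= orient (w i) (w (ordS i)) p].

Definition hull_interior : set (R * R) :=
  [set p | forall i, 0 < orient (w i) (w (ordS i)) p].

Lemma hull_bounded : bounded_set hull_region.
Proof.
have i0 : 'I_n by exact: (Ordinal (ltnW (ltnW n_ge3))).
pose A := \sum_i orient (w i) (w (ordS i)) 0.
have leA p i : hull_region p -> orient (w i) (w (ordS i)) p <= A.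
  move=> pV; rewrite /A (sum_orient 0 p) (bigD1 i) //= lerDl.
  by apply: sumr_ge0 => j _; apply: pV.
set a := w i0; set b := w (ordS i0); set c := w (ordS (ordS i0)).
pose D := cross (b - a) (c - b).
have D0 : 0 < D := turn_gt0 i0.
(* Two consecutive edges are not parallel, so Cramer's rule with determinant [D] recovers [p - b]
   from [orient a b p] and [orient b c p], both in the interval from 0 to [A]. *)
have bd (x y z t X Y : R) : 0 <= X <= A -> 0 <= Y <= A ->
    t * D = y * X - x * Y -> `|t + z| <= A * (`|x| + `|y|) / D + `|z|.
  move=> /andP[X0 XA] /andP[Y0 YA] e.
  have -> : t = (y * X - x * Y) / D by rewrite -e mulfK // gt_eqF.
  rewrite (le_trans (ler_normD _ _)) // lerD2r normrM normfV (gtr0_norm D0).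
  rewrite ler_pM2r ?invr_gt0 // (le_trans (ler_normB _ _)) // !normrM.
  rewrite (ger0_norm X0) (ger0_norm Y0) addrC mulrDr !(mulrC A).
  by rewrite lerD // ler_wpM2l.
exists (Num.max (A * (`|b.1 - a.1| + `|c.1 - b.1|) / D + `|b.1|)
            (A * (`|b.2 - a.2| + `|c.2 - b.2|) / D + `|b.2|)).
split=> [|M]; first exact: num_real.
rewrite gt_max => /andP[/ltW leM1 /ltW leM2] p pV /=.
have hX : 0 <= orient a b p <= A by rewrite pV leA.
have hY : 0 <= orient b c p <= A by rewrite pV leA.
have E1 : `|p.1| <= A * (`|b.1 - a.1| + `|c.1 - b.1|) / D + `|b.1|.
  rewrite -{1}(subrK b.1 p.1); apply: bd hX hY _.
  by rewrite !orientE /D /cross /=; ring.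
have E2 : `|p.2| <= A * (`|b.2 - a.2| + `|c.2 - b.2|) / D + `|b.2|.
  rewrite -{1}(subrK b.2 p.2); apply: bd hX hY _.
  by rewrite !orientE /D /cross /=; ring.
have -> : `|p| = Num.max `|p.1| `|p.2| by [].
by rewrite ge_max (le_trans E1) // (le_trans E2).
Qed.

Lemma hull_boundary i p : hull_region p -> orient (w i) (w (ordS i)) p = 0 ->
  edge w i p.
Proof.
move=> pV e0.
set a := w i; set b := w (ordS i).
pose d := dot (b - a) (b - a).
have ba : b != a by rewrite (inj_eq vertex_inj) Sneq.
have d0 : 0 < d.
  have sq : (b.1 - a.1) ^+ 2 + (b.2 - a.2) ^+ 2 != 0.
    rewrite paddr_eq0 ?sqr_ge0 // !sqrf_eq0 !subr_eq0.
    by apply: contra ba => /andP[/eqP e1 /eqP e2]; apply/eqP/injective_projections.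
  by rewrite lt_def /d /dot -!expr2 sq addr_ge0 ?sqr_ge0.
(* The parameter of the orthogonal projection on the edge line; [p] is its own projection, as its
   normal component is [orient a b p], which is 0. *)
pose t := dot (b - a) (p - a) / d.
have e1 : (p.1 - a.1) * d = dot (b - a) (p - a) * (b.1 - a.1).
  have -> : (p.1 - a.1) * d = dot (b - a) (p - a) * (b.1 - a.1)
      - (b.2 - a.2) * orient a b p by rewrite orientE /d /dot /=; ring.
  by rewrite e0 mulr0 subr0.
have e2 : (p.2 - a.2) * d = dot (b - a) (p - a) * (b.2 - a.2).
  have -> : (p.2 - a.2) * d = dot (b - a) (p - a) * (b.2 - a.2)
      + (b.1 - a.1) * orient a b p by rewrite orientE /d /dot /=; ring.
  by rewrite e0 mulr0 addr0.
have dn : d != 0 by rewrite gt_eqF.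
have pE : (1 - t) *: a + t *: b = p.
  have p1 : p.1 = (1 - t) * a.1 + t * b.1.
    apply: (mulIf dn); rewrite -{1}(subrK a.1 p.1) mulrDl e1 /t; field.
    exact: dn.
  have p2 : p.2 = (1 - t) * a.2 + t * b.2.
    apply: (mulIf dn); rewrite -{1}(subrK a.2 p.2) mulrDl e2 /t; field.
    exact: dn.
  by apply: injective_projections; rewrite ?p1 ?p2.
(* The half-plane of the previous edge gives [0 <= t], that of the next edge gives [t <= 1]. *)
exists t => //=; rewrite in_itv /=; apply/andP; split.
  have := pV (ord_pred i); rewrite ord_predK -pE orient_line orient_right.
  rewrite mulr0 add0r pmulr_lge0 //.
  have := convex (i := ord_pred i) (j := ordS i); rewrite ord_predK; apply=> //.
  by have := SSneq (ord_pred i); rewrite ord_predK.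
have := pV (ordS i); rewrite -pE orient_line orient_left.
rewrite mulr0 addr0 pmulr_lge0 ?subr_ge0 //.
by apply: convex; rewrite eq_sym.
Qed.

Lemma hull_interior_open : open hull_interior.
Proof.
rewrite openE => p pU; apply: (@filter_forall _ _ _ (nbhs p)) => i.
have /cvgr_gt := @orient_continuous _ (w i) (w (ordS i)) p.
by apply; exact: pU.
Qed.

Lemma hull_region_closed : closed hull_region.
Proof.
have -> : hull_region =
    \bigcap_(i in [set: 'I_n]) orient (w i) (w (ordS i)) @^-1` [set x | 0 <= x].
  by apply/seteqP; split=> [p pV i _|p pV i]; [exact: pV|exact: pV].
apply: closed_bigI => i _; apply: preimage_closed (@closed_ge _ _).
by move=> p _; exact: orient_continuous.
Qed.

(* Off the chain, [hull_interior] and [hull_region] agree, so the hull is clopen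
   there and contains the whole component of each of its points. *)
Lemma hull_sub_region : hull_region `<=` region w.
Proof.
move=> p pV; have [pc|pc] := pselect (chain w p); first by left.
right; split=> //.
have VU q : ~ chain w q -> hull_region q -> hull_interior q.
  move=> qc qV i; rewrite lt_def qV andbT; apply: contra_notN qc => /eqP e.
  by exists i => //; exact: hull_boundary.
apply: sub_boundedr hull_bounded => B /= hB q [C [Cp Csub Cc] Cq].
apply: hB; suff E : C `&` hull_region = C by move: Cq; rewrite -E => -[].
apply: Cc.
- by exists p.
- exists hull_interior; first exact: hull_interior_open.
  apply/seteqP; split=> q' [Cq' q'V]; split=> //.
    by apply: VU => //; exact: Csub.
  by move=> i; exact/ltW.
- by exists hull_region => //; exact: hull_region_closed.
Qed.

(** Along the normal at an inner point of edge [i], each [orient] is affine in [t]. For edge [i] it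
    starts at 0 with slope the squared edge length; for any other edge it starts positive and stays
    so for small [t]. *)
Lemma ccw_convex : counterclockwise w.
Proof.
move=> i s /andP[s0 s1].
have : \forall t \near 0^'+, forall j : 'I_n, 0 <= orient (w j) (w (ordS j))
  ((1 - s) *: w i + s *: w (ordS i) + t *: rot90 (w (ordS i) - w i)).
  apply: filter_forall => j.
  pose b := dot (w (ordS j) - w j) (w (ordS i) - w i).
  have E t : orient (w j) (w (ordS j))
      ((1 - s) *: w i + s *: w (ordS i) + t *: rot90 (w (ordS i) - w i)) =
      (1 - s) * orient (w j) (w (ordS j)) (w i)
      + s * orient (w j) (w (ordS j)) (w (ordS i)) + t * b.
    by rewrite -orient_line !orientE /b /dot /rot90 /= /GRing.scale /=; ring.
  have [ji|ji] := eqVneq j i.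
    near=> t; rewrite E ji orient_left orient_right !mulr0 !add0r mulr_ge0 //.
    by rewrite /b ji /dot addr_ge0 // -expr2 sqr_ge0.
  set a := (1 - s) * orient (w j) (w (ordS j)) (w i)
      + s * orient (w j) (w (ordS j)) (w (ordS i)) in E.
  have a0 : 0 < a.
    rewrite /a; have [iSj|iSj] := eqVneq i (ordS j).
      rewrite ltr_wpDl ?mulr_ge0 ?vertex_orient_ge0 ?subr_ge0 ?(ltW s1) //.
      by rewrite mulr_gt0 // iSj convex.
    rewrite ltr_pwDl ?mulr_ge0 ?vertex_orient_ge0 ?(ltW s0) //.
    by rewrite mulr_gt0 ?convex // ?subr_gt0 // eq_sym.
  (* The added 1 keeps the threshold for [t] defined when the slope [b] is 0. *)
  have b0 : 0 < `|b| + 1 by rewrite ltr_wpDl.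
  near=> t; rewrite E.
  have t0 : 0 < t by [].
  have ta : t * (`|b| + 1) < a by rewrite -ltr_pdivlMr //; near: t; apply: nbhs_right_lt; rewrite divr_gt0.
  have : - (t * b) <= t * `|b| by rewrite -mulrN ler_pM2l // -normrN ler_norm.
  lra.
by apply: filterS => t; exact: hull_sub_region.
Unshelve. all: by end_near.
Qed.

(** The positive cross product selects the [acos] branch, and by Lagrange's identity it makes
    Cauchy-Schwarz strict, so the cosine exceeds -1. *)
Lemma interior_angle_convex i : interior_angle w i < pi.
Proof.
rewrite /interior_angle; set u := w (ordS i) - w i; set v := w (ord_pred i) - w i.
have c0 : 0 < cross u v.
  apply: convex; first by have := Sneq (ord_pred i); rewrite ord_predK eq_sym.
  by have := SSneq (ord_pred i); rewrite ord_predK eq_sym.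
rewrite /ccw_angle ltW //.
have lag : dot u v ^+ 2 + cross u v ^+ 2 = dot u u * dot v v.
  by rewrite /dot /cross; ring.
have duv : 0 < dot u u * dot v v by rewrite -lag ltr_wpDl ?sqr_ge0 ?exprn_gt0.
have duu : 0 <= dot u u by rewrite addr_ge0 // -expr2 sqr_ge0.
have N0 : 0 < enorm u * enorm v by rewrite /enorm -sqrtrM // sqrtr_gt0.
have NE : (enorm u * enorm v) ^+ 2 = dot u u * dot v v.
  by rewrite /enorm -sqrtrM // sqr_sqrtr // ltW.
have : `|dot u v| < enorm u * enorm v.
  rewrite -(ltr_pXn2r (n:=2)) ?nnegrE ?(ltW N0) // NE -lag real_normK ?num_real //.
  by rewrite ltrDl exprn_gt0.
rewrite ltr_norml => /andP[l1 l2]; apply: acos_ltpi.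
by rewrite ltr_pdivlMr // ler_pdivrMr // mulN1r mul1r l1 ltW.
Qed.

Lemma ccw_strictly_convex : ccw_strictly_convex_polygon w.
Proof.
by split; [exact: simple_convex|exact: ccw_convex|exact: interior_angle_convex].
Qed.

End ConvexPolygon.

(** * Rational parametrization of an ellipse centred at the origin *)

Section Ellipse.
Context {R : realType}.
Implicit Types (d L t u x : R).

(* The point of parameter [t] of the ellipse with half axes [d] and [L]; as [t]
   increases it runs counterclockwise from [(- d, 0)], which is excluded. *)
Definition ellipse_point d L t : R * R :=
  (d * ((1 - t ^+ 2) / (1 + t ^+ 2)), L * (2 * t / (1 + t ^+ 2))).

Lemma addr1_sqr_gt0 t : 0 < 1 + t ^+ 2.
Proof. by rewrite ltr_pwDl ?sqr_ge0. Qed.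

(** The last factor is a Vandermonde product: for positive half axes, the orientation depends only
    on the cyclic order of the parameters. *)
Lemma orient_ellipse d L t1 t2 t3 :
  orient (ellipse_point d L t1) (ellipse_point d L t2) (ellipse_point d L t3) =
  4 * d * L / ((1 + t1 ^+ 2) * (1 + t2 ^+ 2) * (1 + t3 ^+ 2))
  * ((t2 - t1) * (t3 - t2) * (t3 - t1)).
Proof.
have h t : 1 + t ^+ 2 != 0 by rewrite gt_eqF ?addr1_sqr_gt0.
rewrite orientE /ellipse_point /=; field.
by rewrite !h.
Qed.

Lemma ellipse_radius d L r : 0 < d -> d < r -> r < L ->
  exists2 t, 0 < t < 1 &
    forall t', t' ^+ 2 = t ^+ 2 \/ t' ^+ 2 = t ^- 2 ->
      Defs.edist (0, 0) (ellipse_point d L t') = r.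
Proof.
move=> d0 dr rL.
have r0 := lt_trans d0 dr; have L0 := lt_trans r0 rL.
have sq x y : 0 < x -> x < y -> x ^+ 2 < y ^+ 2.
  by move=> x0 xy; rewrite ltr_pXn2r // nnegrE ?ltW // (lt_trans x0).
have dr2 := sq _ _ d0 dr; have rL2 := sq _ _ r0 rL.
(* [Q] is the squared cosine solving [d ^+ 2 * Q + L ^+ 2 * (1 - Q) = r ^+ 2]. *)
pose Q := (L ^+ 2 - r ^+ 2) / (L ^+ 2 - d ^+ 2).
have den : 0 < L ^+ 2 - d ^+ 2 by lra.
have Q0 : 0 < Q by rewrite divr_gt0 // subr_gt0.
have Q1 : Q < 1 by rewrite ltr_pdivrMr // mul1r; lra.
pose X := Num.sqrt Q.
have X0 : 0 < X by rewrite sqrtr_gt0.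
have XQ : X ^+ 2 = Q by rewrite sqr_sqrtr // ltW.
have X1 : X < 1.
  by rewrite -(ltr_pXn2r (n := 2)) ?nnegrE ?ltW // XQ expr1n.
(* The squared tangent of the half-angle with cosine [X]; its inverse belongs to the cosine
   [- X]. *)
pose u := (1 - X) / (1 + X).
have u0 : 0 < u by rewrite divr_gt0 //; lra.
have u1 : u < 1 by rewrite ltr_pdivrMr; lra.
exists (Num.sqrt u).
  by rewrite sqrtr_gt0 u0 -sqrtr1 ltr_sqrt.
rewrite (sqr_sqrtr (ltW u0)) => t' ht.
suff e2 : ((1 - t' ^+ 2) / (1 + t' ^+ 2)) ^+ 2 = X ^+ 2.
  have h : 1 + t' ^+ 2 != 0 by rewrite gt_eqF ?addr1_sqr_gt0.
  have e3 : (2 * t' / (1 + t' ^+ 2)) ^+ 2 =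
      1 - ((1 - t' ^+ 2) / (1 + t' ^+ 2)) ^+ 2 by field.
  rewrite /Defs.edist /enorm.
  have -> : dot ((0, 0) - ellipse_point d L t') ((0, 0) - ellipse_point d L t') =
      d ^+ 2 * ((1 - t' ^+ 2) / (1 + t' ^+ 2)) ^+ 2 +
      L ^+ 2 * (2 * t' / (1 + t' ^+ 2)) ^+ 2.
    by rewrite /dot /ellipse_point /=; ring.
  have -> : d ^+ 2 * ((1 - t' ^+ 2) / (1 + t' ^+ 2)) ^+ 2 +
      L ^+ 2 * (2 * t' / (1 + t' ^+ 2)) ^+ 2 = r ^+ 2.
    rewrite e3 e2 XQ /Q; field; exact: lt0r_neq0.
  by rewrite sqrtr_sqr ger0_norm // ltW.
have X1n : 1 + X != 0 by rewrite gt_eqF //; lra.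
have X2n : 1 - X != 0 by rewrite gt_eqF //; lra.
have E2 : (1 - X) + (1 + X) != 0 by rewrite gt_eqF //; lra.
case: ht => ->.
  by rewrite /u; field; rewrite X1n addrC.
by rewrite /u; field; rewrite X1n X2n.
Qed.

(* For [0 < t < 1], the points of parameter [quadrant q t] are the reflections
   in the axes of the one of parameter [t], one in each open quadrant. *)
Definition quadrant (q : nat) t : R :=
  match q with 0 => t | 1 => t^-1 | 2 => - t^-1 | _ => - t end.

Lemma quadrant_sqr q t :
  quadrant q t ^+ 2 = t ^+ 2 \/ quadrant q t ^+ 2 = t ^- 2.
Proof.
by case: q => [|[|[|q]]] /=; rewrite ?sqrrN ?exprVn; [left|right|right|left].
Qed.

Lemma quadrant_inj t : 0 < t < 1 -> {in gtn 4 &, injective (quadrant^~ t)}.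
Proof.
move=> /andP[t0 t1].
have t2 : 1 < t^-1 by rewrite invf_gt1.
by move=> [|[|[|[|//]]]] [|[|[|[|//]]]] _ _ //= e; exfalso; lra.
Qed.

(* No half-plane missing the origin contains a point of each open quadrant. *)
Lemma ellipse_quadrants d L (a b : R) : 0 < d -> 0 < L ->
  exists2 q, (q < 4)%N & forall t, 0 < t < 1 ->
    a * (ellipse_point d L (quadrant q t)).2 <=
    b * (ellipse_point d L (quadrant q t)).1.
Proof.
move=> d0 L0.
have in_quadrant q t : 0 < t < 1 ->
    let p := ellipse_point d L (quadrant q t) in
    (if (q == 0)%N || (2 < q)%N then 0 <= p.1 else p.1 <= 0) /\
    (if (q < 2)%N then 0 <= p.2 else p.2 <= 0).
  move=> /andP[t0 t1] p.
  have t2 : 1 < t^-1 by rewrite invf_gt1.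
  have h (z : R) : 0 < (1 + z ^+ 2)^-1 by rewrite invr_gt0 addr1_sqr_gt0.
  have s1 : 0 <= 1 - t ^+ 2 by nra.
  have s2 : 1 - t^-1 ^+ 2 <= 0 by nra.
  rewrite /p /ellipse_point; case: q {p} => [|[|[|q]]] /=.
  - by rewrite !(pmulr_rge0 _ d0, pmulr_rge0 _ L0, pmulr_lge0 _ (h _)) s1 pmulr_rge0 // ltW.
  - rewrite !(pmulr_rle0 _ d0, pmulr_rge0 _ L0, pmulr_lge0 _ (h _), pmulr_lle0 _ (h _)) s2.
    by rewrite pmulr_rge0 // invr_ge0 ltW.
  - rewrite !(pmulr_rle0 _ d0, pmulr_rle0 _ L0, pmulr_lle0 _ (h _)) sqrrN s2.
    by rewrite pmulr_rle0 // oppr_le0 invr_ge0 ltW.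
  - rewrite !(pmulr_rge0 _ d0, pmulr_rle0 _ L0, pmulr_lge0 _ (h _), pmulr_lle0 _ (h _)) sqrrN s1.
    by rewrite pmulr_rle0 // oppr_le0 ltW.
have [a0|/ltW a0] := leP a 0; have [b0|/ltW b0] := leP b 0.
- by exists 1%N => // t /(in_quadrant 1%N)[/= x y]; nra.
- by exists 0%N => // t /(in_quadrant 0%N)[/= x y]; nra.
- by exists 2%N => // t /(in_quadrant 2%N)[/= x y]; nra.
- by exists 3%N => // t /(in_quadrant 3%N)[/= x y]; nra.
Qed.

End Ellipse.

(** * Points of an ellipse listed by increasing parameter *)

Lemma sorted_enumeration {R : realType} (I : finType) (t : I -> R) :
  injective t -> exists2 s : 'I_#|I| -> I,
    bijective s & forall i j : 'I_#|I|, (i < j)%N -> t (s i) < t (s j).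
Proof.
move=> t_inj; pose le a b := t a <= t b.
pose s (i : 'I_#|I|) := tnth (sort_tuple le (enum_tuple I)) i.
have s_inj : injective s.
  by apply/tuple_uniqP; rewrite /= sort_uniq enum_uniq.
exists s; first by apply: inj_card_bij => //; rewrite card_ord.
move=> i j ij; rewrite lt_neqAle (inj_eq t_inj) (inj_eq s_inj) -val_eqE /= ltn_eqF //=.
have le_trans : transitive le by move=> y x z; exact: le_trans.
have srt : sorted le (sort le (enum I)) by apply: sort_sorted => x y; exact: le_total.
rewrite -/(le _ _) /s !(tnth_nth (s i)).
apply: (sorted_ltn_nth le_trans) => //; by rewrite inE size_sort -cardE.
Qed.

(** In the Vandermonde product either no factor or exactly two are negative. *)
Lemma sorted_ellipse_convex {R : realType} n (d L : R) (t : 'I_n -> R) :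
  0 < d -> 0 < L -> (forall i j : 'I_n, (i < j)%N -> t i < t j) ->
  forall i j : 'I_n, j != i -> j != ordS i ->
  0 < orient (ellipse_point d L (t i)) (ellipse_point d L (t (ordS i)))
             (ellipse_point d L (t j)).
Proof.
move=> d0 L0 tlt i j ji jSi.
rewrite orient_ellipse mulr_gt0 //.
  by rewrite divr_gt0 ?mulr_gt0 // addr1_sqr_gt0.
have tneq (a b : 'I_n) : a != b -> (t a < t b) = (a < b)%N.
  rewrite neq_ltn => /orP[ab|ba]; first by rewrite tlt ?ab.
  by rewrite ltNge (ltW (tlt _ _ ba)) ltnNge (ltnW ba).
have [l|g] := ltnP i.+1 n.
  have Si : val (ordS i) = i.+1 by rewrite /= modn_small.
  have h1 : t i < t (ordS i) by apply: tlt; rewrite Si.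
  have : (j < i)%N \/ (i.+1 < j)%N.
    have jSi' : (val j != i.+1)%N by rewrite -Si.
    have : (val j != i)%N by [].
    rewrite neq_ltn => /orP[|ij]; [by left|right].
    by rewrite ltn_neqAle eq_sym jSi'.
  case=> [lt_ji|lt_Sij].
    have := tlt _ _ lt_ji => h2.
    by rewrite -mulrA mulr_gt0 ?subr_gt0 // nmulr_rgt0 ?subr_lt0 // (lt_trans h2).
  have h2 : t (ordS i) < t j by apply: tlt; rewrite Si.
  by rewrite !mulr_gt0 ?subr_gt0 // (lt_trans h1).
(* The closing edge, from the largest parameter back to the smallest; all others lie between. *)
have e : i.+1 = n by apply/eqP; rewrite eqn_leq ltn_ord g.
have Si : val (ordS i) = 0%N by rewrite /= {1}e modnn.
have hj : (0 < j)%N by rewrite lt0n -Si.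
have h1 : t (ordS i) < t j by apply: tlt; rewrite Si.
have h2 : t j < t i.
  by apply: tlt; have := ltn_ord j; rewrite -{2}e ltnS leq_eqVlt (negbTE (_ : val j != i)).
rewrite nmulr_rgt0 ?subr_lt0 // nmulr_rlt0 ?subr_gt0 // subr_lt0.
exact: lt_trans h2.
Qed.

Lemma ellipse_configuration {R : realType} (I : finType) (r : I -> R) (d L : R)
    (t : I -> R) (q : I -> nat) :
  (3 < #|I|)%N -> 0 < d -> 0 < L -> (forall a, 0 < t a < 1) ->
  (forall a, Defs.edist (0, 0) (ellipse_point d L (quadrant (q a) (t a))) = r a) ->
  injective (fun a => quadrant (q a) (t a)) ->
  (forall m, (m < 4)%N -> exists a, q a = m) ->
  strictly_convex_configuration r (fun a => ellipse_point d L (quadrant (q a) (t a))).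
Proof.
move=> n4 d0 L0 t01 rE u_inj q_surj.
have n3 := ltnW n4.
have [s s_bij s_lt] := sorted_enumeration u_inj.
have convex := sorted_ellipse_convex d0 L0 s_lt.
set v := fun a => _; pose w := v \o s.
split=> //.
- have w_inj : injective w by exact: vertex_inj n3 convex.
  by case: s_bij => s' sK s'K a b; rewrite -(s'K a) -(s'K b) => /w_inj ->.
- exists s; split=> //; first exact: (ccw_strictly_convex n3 convex).
  apply: (hull_sub_region n3 convex) => i.
  set x := v (s i); set y := v (s (ordS i)).
  (* Some vertex [v a] has a position vector that does not point to the left of this edge. It lies
     in the left half-plane of the edge, hence so does the origin. *)
  have [m m4 hm] := ellipse_quadrants (y.1 - x.1) (y.2 - x.2) d0 L0.
  have [a qa] := q_surj _ m4.
  have := vertex_orient_ge0 convex i; case: s_bij => s' sK s'K.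
  move=> /(_ (s' a)); rewrite /= s'K -/x -/y.
  have := hm _ (t01 a); rewrite -qa -/(v a) !orientE /=.
  lra.
Qed.

(** * Choice of the half axes and of the quadrants *)

Theorem theorem2 (R : realType) (k : nat) (m : 'I_k -> nat)
    (r : forall i : 'I_k, 'I_(m i) -> R)
    (k_ge1 : (1 <= k)%N)
    (m_bound : forall i : 'I_k, (1 <= m i <= 4)%N)
    (n_gt3 : (3 < \sum_(i < k) m i)%N)
    (r_pos : forall (i : 'I_k) (j : 'I_(m i)), 0 < r i j)
    (r_eq : forall (i : 'I_k) (j j' : 'I_(m i)), r i j = r i j')
    (r_neq : forall (i i' : 'I_k) (j : 'I_(m i)) (j' : 'I_(m i')),
       i != i' -> r i j != r i' j') :
  exists v : {i : 'I_k & 'I_(m i)} -> R * R,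
    strictly_convex_configuration
      (fun ij : {i : 'I_k & 'I_(m i)} => r (tag ij) (tagged ij)) v.
Proof.
pose rad (a : {i : 'I_k & 'I_(m i)}) := r (tag a) (tagged a).
have rad0 a : 0 < rad a by exact: r_pos.
pose L := 1 + \sum_a rad a.
have radL a : rad a < L.
  rewrite /L (bigD1 a) //= addrCA ltrDl ltr_pwDl //.
  by apply: sumr_ge0 => b _; exact/ltW.
(* [D] exceeds every inverse radius, so the half axis [D^-1] is below every radius. *)
pose D := 1 + \sum_a (rad a)^-1.
have D_ge a : (rad a)^-1 < D.
  rewrite /D (bigD1 a) //= addrCA ltrDl ltr_pwDl //.
  by apply: sumr_ge0 => b _; rewrite invr_ge0 ltW.
have D0 : 0 < D.
  by rewrite ltr_pwDl //; apply: sumr_ge0 => b _; rewrite invr_ge0 ltW.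
have d0 : 0 < D^-1 by rewrite invr_gt0.
have drad a : D^-1 < rad a by rewrite invf_plt ?posrE.
have L0 : 0 < L by rewrite ltr_pwDl //; apply: sumr_ge0 => b _; rewrite ltW.
(* The parameter is chosen as a function of the radius value, so that equal radii share it; the
   value 0 is a dummy outside the admissible range. *)
have base (x : R) : exists t, D^-1 < x -> x < L -> 0 < t < 1 /\
    forall t', t' ^+ 2 = t ^+ 2 \/ t' ^+ 2 = t ^- 2 ->
      Defs.edist (0, 0) (ellipse_point D^-1 L t') = x.
  have [dx|dx] := boolP (D^-1 < x); last by exists 0.
  have [xL|xL] := boolP (x < L); last by exists 0.
  by have [t t01 ht] := ellipse_radius d0 dx xL; exists t.
have {base} [t tP] := choice base.
have t01 a : 0 < t (rad a) < 1 by have [] := tP _ (drad a) (radL a).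
(* The points of a circle have at most four consecutive ranks, hence lie in
   distinct quadrants. *)
pose q (a : {i : 'I_k & 'I_(m i)}) := (tagnat.rank a %% 4)%N.
have rE a : Defs.edist (0, 0) (ellipse_point D^-1 L (quadrant (q a) (t (rad a)))) = rad a.
  have [_] := tP _ (drad a) (radL a); apply; exact: quadrant_sqr.
exists (fun a => ellipse_point D^-1 L (quadrant (q a) (t (rad a)))).
apply: (ellipse_configuration (r := rad) (t := t \o rad)) => //=.
- by rewrite tagnat.card.
- move=> a b e.
  (* Equal parameters give the same point, hence the same radius and then the same quadrant. *)
  have rab : rad a = rad b by rewrite -rE e rE.
  have : q a = q b.
    by move: e; rewrite rab; apply: quadrant_inj; rewrite // inE ltn_pmod.
  have tab : tag a = tag b.
    apply/eqP; apply: contraT => ab.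
    move: (r_neq _ _ (tagged a) (tagged b) ab).
    by rewrite -/(rad a) -/(rad b) rab eqxx.
  case: a b tab {e rab} => [i j] [i' j'] /= ii'; subst i'.
  rewrite /q !tagnat.rankEsum /= => /eqP; rewrite eqn_modDl => /eqP.
  have m4 (l : 'I_(m i)) : (l < 4)%N.
    by have /andP[_] := m_bound i; exact: leq_trans.
  by rewrite !modn_small // => /val_inj ->.
- move=> p p4.
  (* The point of rank [p] exists because there are at least four points. *)
  have pn := leq_trans p4 n_gt3.
  by exists (tagnat.sig (Ordinal pn)); rewrite /q tagnat.sigK modn_small.
Qed.
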